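(* Let $m\in\mathbb{N}_+$ and let $\alpha_1,\ldots,\alpha_m\in\mathbb{C}$. The formal inverse (for composition) of $a(X)=X(1-(\alpha_1X+\cdots+\alpha_mX^m))$ is $$a^{-1}(X)=X\Big(1+\sum_{n\ge 1}\frac{1}{n+1}u_nX^n\Big),$$ where for all $n\ge 1$ $$u_n=\frac{1}{n!}\sum_{j_1+2j_2+\cdots+mj_m=n}\frac{(n+j_1+\cdots+j_m)!}{j_1!\cdots j_m!}\,\alpha_1^{j_1}\cdots\alpha_m^{j_m}.$$ Moreover, if $m\ge 2$ and $\alpha_1\ne 0$, then, with $x_k=\alpha_k/\alpha_1^k$ for all $k\in\{2,\ldots,m\}$, $$u_n=\frac{\alpha_1^n}{n!}\sum_{2j_2+\cdots+mj_m\le n}\frac{(2n-j_2-2j_3-\cdots-(m-1)j_m)!}{(n-2j_2-\cdots-mj_m)!\,j_2!\cdots j_m!}\,x_2^{j_2}\cdots x_m^{j_m}.$$ In particular, when $m=2$ and $\alpha_1\neq 0$, with $x=\alpha_2/\alpha_1^2$, $$u_n=\frac{\alpha_1^n}{n!}\sum_{0\le k\le n/2}\frac{(2n-k)!}{(n-2k)!\,k!}\,x^k.$$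
   Context: $\mathbb{N}_+$ is the set of positive integers. All summation indices $j_1,\ldots,j_m,k$ range over nonnegative integers. The formal inverse of a power series $a(X)\in\mathbb{C}[[X]]$ with $a(X)\equiv X$ mod $X^2$ is the unique power series $a^{-1}(X)\in X\mathbb{C}[[X]]$ with $a(a^{-1}(X))=a^{-1}(a(X))=X$. *)

(* Defs.v *)
From HB Require Import structures.
From mathcomp Require Import all_boot all_order all_algebra.
From mathcomp Require Import boolp reals.
From mathcomp Require Import complex.

Set Implicit Arguments.
Unset Strict Implicit.
Unset Printing Implicit Defensive.

Import GRing.Theory.
Local Open Scope ring_scope.

(* [FPS c] is the formal power series \sum_n (c n) X^n. *)
Record fps (K : Type) := FPS { fps_coef : nat -> K }.

Lemma fpsP (K : Type) (a b : fps K) : fps_coef a =1 fps_coef b <-> a = b.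
Proof.
split=> [|-> //]; case: a b => [a] [b] /= eq_ab.
by congr FPS; apply: funext.
Qed.

HB.instance Definition _ (K : Type) := gen_eqMixin (fps K).
HB.instance Definition _ (K : Type) := gen_choiceMixin (fps K).

Section FpsRing.
Variable K : comNzRingType.
Implicit Types a b c : fps K.

Definition fps_zero : fps K := FPS (fun=> 0).
Definition fps_one : fps K := FPS (fun n => (n == 0%N)%:R).
Definition fps_opp a : fps K := FPS (fun n => - fps_coef a n).
Definition fps_add a b : fps K := FPS (fun n => fps_coef a n + fps_coef b n).
Definition fps_mul a b : fps K :=
  FPS (fun n => \sum_(j < n.+1) fps_coef a j * fps_coef b (n - j)).
Definition fps_scale (x : K) a : fps K := FPS (fun n => x * fps_coef a n).

Fact fps_addA : associative fps_add.
Proof. by move=> a b c; apply/fpsP => n /=; rewrite addrA. Qed.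
Fact fps_addC : commutative fps_add.
Proof. by move=> a b; apply/fpsP => n /=; rewrite addrC. Qed.
Fact fps_add0 : left_id fps_zero fps_add.
Proof. by move=> a; apply/fpsP => n /=; rewrite add0r. Qed.
Fact fps_addN : left_inverse fps_zero fps_opp fps_add.
Proof. by move=> a; apply/fpsP => n /=; rewrite addNr. Qed.

HB.instance Definition _ := GRing.isZmodule.Build (fps K)
  fps_addA fps_addC fps_add0 fps_addN.

Definition fps_trunc N a : {poly K} := \poly_(i < N) fps_coef a i.

Lemma coef_fps_trunc N a i : (i < N)%N -> (fps_trunc N a)`_i = fps_coef a i.
Proof. by move=> lt_iN; rewrite coef_poly lt_iN. Qed.

Lemma fps_mul_trunc N a b n : (n < N)%N ->
  fps_coef (fps_mul a b) n = (fps_trunc N a * fps_trunc N b)`_n.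
Proof.
move=> lt_nN; rewrite coefM /=; apply: eq_bigr => j _.
rewrite !coef_fps_trunc //; first exact: leq_ltn_trans (leq_subr _ _) lt_nN.
exact: leq_ltn_trans (leq_ord j) lt_nN.
Qed.

Fact fps_mulA : associative fps_mul.
Proof.
move=> a b c; apply/fpsP => n.
have trunc_mul x y i : (i <= n)%N ->
    (fps_trunc n.+1 (fps_mul x y))`_i
      = (fps_trunc n.+1 x * fps_trunc n.+1 y)`_i.
  by move=> le_in; rewrite coef_fps_trunc // (fps_mul_trunc (N := n.+1)).
rewrite !(fps_mul_trunc (N := n.+1)) //.
transitivity (fps_trunc n.+1 a * (fps_trunc n.+1 b * fps_trunc n.+1 c))`_n.
  rewrite !coefM; apply: eq_bigr => j _.
  by rewrite trunc_mul ?leq_subr.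
rewrite mulrA !coefM; apply: eq_bigr => j _.
by rewrite trunc_mul // leq_ord.
Qed.
Fact fps_mulC : commutative fps_mul.
Proof.
by move=> a b; apply/fpsP => n; rewrite !(fps_mul_trunc (N := n.+1)) // mulrC.
Qed.
Fact fps_mul1 : left_id fps_one fps_mul.
Proof.
move=> a; apply/fpsP => n /=; rewrite big_ord_recl /= mul1r subn0.
by rewrite big1 ?addr0 // => j _; rewrite mul0r.
Qed.
Fact fps_mulDl : left_distributive fps_mul fps_add.
Proof.
move=> a b c; apply/fpsP => n /=; rewrite -big_split /=.
by apply: eq_bigr => j _; rewrite mulrDl.
Qed.
Fact fps_one_neq0 : fps_one != 0 :> fps K.
Proof.
by apply/eqP => /fpsP/(_ 0%N) /= /eqP; rewrite oner_eq0.
Qed.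

HB.instance Definition _ := GRing.Zmodule_isComNzRing.Build (fps K)
  fps_mulA fps_mulC fps_mul1 fps_mulDl fps_one_neq0.

Fact fps_scaleA x y a : fps_scale x (fps_scale y a) = fps_scale (x * y) a.
Proof. by apply/fpsP => n /=; rewrite mulrA. Qed.
Fact fps_scale1 : left_id 1 fps_scale.
Proof. by move=> a; apply/fpsP => n /=; rewrite mul1r. Qed.
Fact fps_scaleDr : right_distributive fps_scale +%R.
Proof. by move=> x a b; apply/fpsP => n /=; rewrite mulrDr. Qed.
Fact fps_scaleDl a : {morph fps_scale^~ a : x y / x + y}.
Proof. by move=> x y; apply/fpsP => n /=; rewrite mulrDl. Qed.

HB.instance Definition _ := GRing.Zmodule_isLmodule.Build K (fps K)
  fps_scaleA fps_scale1 fps_scaleDr fps_scaleDl.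

Fact fps_scaleAl (x : K) a b : x *: (a * b) = (x *: a) * b.
Proof.
apply/fpsP => n /=; rewrite mulr_sumr.
by apply: eq_bigr => j _; rewrite mulrA.
Qed.

HB.instance Definition _ := GRing.Lmodule_isLalgebra.Build K (fps K)
  fps_scaleAl.

Definition fpsX : fps K := FPS (fun n => (n == 1%N)%:R).

(* The composition a(b(X)) = \sum_k a_k b(X)^k; it is only meaningful when b
   has zero constant term, in which case b^k only contributes to the
   coefficients of index n >= k. *)
Definition fps_comp a b : fps K :=
  FPS (fun n => \sum_(k < n.+1) fps_coef a k * fps_coef (b ^+ k) n).

Definition formal_inverse a b : Prop :=
  [/\ fps_coef b 0 = 0, fps_comp a b = fpsX & fps_comp b a = fpsX].

End FpsRing.

Arguments fpsX {K}.

(* Since i >= 1 for every index i, the constraint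
   j_1 + 2 j_2 + ... + m j_m = n forces every j_i <= n: summing over
   j : {ffun 'I_m -> 'I_n.+1} loses no term.  The ordinal i < m stands for the
   index i + 1, so that [j i] is j_(i+1). *)
Definition inv_coef (K : fieldType) (m : nat) (alpha : nat -> K) (n : nat) : K :=
  (n`!)%:R^-1 *
  \sum_(j : {ffun 'I_m -> 'I_n.+1} | (\sum_(i < m) i.+1 * j i == n)%N)
    ((n + \sum_(i < m) j i)`!)%:R / (\prod_(i < m) (j i)`!)%:R
    * \prod_(i < m) alpha i.+1 ^+ j i.

(* Main.v *)
From HB Require Import structures.
Require Import Defs.
From mathcomp Require Import all_boot all_order all_algebra.
From mathcomp Require Import reals complex.
From mathcomp Require Import ring zify.

Set Implicit Arguments.
Unset Strict Implicit.
Unset Printing Implicit Defensive.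

Import GRing.Theory.
Local Open Scope ring_scope.

(* Lagrange inversion. Write a = X q with q = 1 - p, p = \sum_k alpha_k X^k, and
   phi = 1 / q, so that a = X / phi. For every series f, comparing residues in
   (f o a)' = \sum_k k f_k a^(k-1) a' gives
     [X^n] (f o a)' phi^(n+1) = (n+1) f_(n+1).
   Taking f = b with b o a = X shows that the inverse has coefficients
   b_(n+1) = [X^n] phi^(n+1) / (n+1); conversely, for these coefficients the
   triangular system [X^n] h phi^(n+1) = 0 forces h = (b o a)' - 1 to vanish.
   Expanding phi^(n+1) = \sum_s 'C(n+s, s) p^s and then p^s by the multinomial
   theorem gives u_n = [X^n] phi^(n+1). The other two formulas come from solving
   the weight constraint for j_1. *)

(** * Coefficients, composition and derivation of formal power series *)

Section FpsTheory.
Variable K : comNzRingType.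
Implicit Types (a b f g p q : fps K) (x : K) (n k : nat).

Lemma coef_fpsD a b n : fps_coef (a + b) n = fps_coef a n + fps_coef b n.
Proof. by []. Qed.

Lemma coef_fpsB a b n : fps_coef (a - b) n = fps_coef a n - fps_coef b n.
Proof. by []. Qed.

Lemma coef_fpsZ x a n : fps_coef (x *: a) n = x * fps_coef a n.
Proof. by []. Qed.

Lemma coef_fps1 n : fps_coef (1 : fps K) n = (n == 0%N)%:R.
Proof. by []. Qed.

Lemma coef_fpsM a b n :
  fps_coef (a * b) n = \sum_(j < n.+1) fps_coef a j * fps_coef b (n - j).
Proof. by []. Qed.

Lemma coef_fps_sum (I : Type) (r : seq I) (P : pred I) (F : I -> fps K) n :
  fps_coef (\sum_(i <- r | P i) F i) n
    = \sum_(i <- r | P i) fps_coef (F i) n.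
Proof. by apply: (big_morph (fun a => fps_coef a n)). Qed.

Lemma coef_fpsMn a k n : fps_coef (a *+ k) n = fps_coef a n *+ k.
Proof. by elim: k => // k IHk; rewrite !mulrS coef_fpsD IHk. Qed.

Lemma coef_fpsM0 a b : fps_coef (a * b) 0 = fps_coef a 0 * fps_coef b 0.
Proof. by rewrite coef_fpsM big_ord1. Qed.

Lemma coef_fpsX0 a k : fps_coef (a ^+ k) 0 = fps_coef a 0 ^+ k.
Proof. by elim: k => // k IHk; rewrite !exprS coef_fpsM0 IHk. Qed.

Lemma coef_fpsXM0 a : fps_coef (fpsX * a) 0 = 0.
Proof. by rewrite coef_fpsM0 mul0r. Qed.

Lemma coef_fpsXMS a n : fps_coef (fpsX * a) n.+1 = fps_coef a n.
Proof.
rewrite coef_fpsM !big_ord_recl /= mul0r add0r mul1r subn1 /=.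
by rewrite big1 ?addr0 // => i _; rewrite mul0r.
Qed.

Lemma coef_fpsXnM a k n :
  fps_coef (fpsX ^+ k * a) n = if (n < k)%N then 0 else fps_coef a (n - k).
Proof.
elim: k n => [|k IHk] n; first by rewrite mul1r subn0.
rewrite exprS -mulrA; case: n => [|n]; first by rewrite coef_fpsXM0.
by rewrite coef_fpsXMS IHk ltnS subSS.
Qed.

Lemma coef_fpsXn k n : fps_coef (fpsX ^+ k : fps K) n = (n == k)%:R.
Proof.
rewrite -[fpsX ^+ k]mulr1 coef_fpsXnM coef_fps1 subn_eq0 eqn_leq.
by case: ltnP => _; rewrite ?andbF ?andbT.
Qed.

Lemma coef_fps_exp_lt p k n :
  fps_coef p 0 = 0 -> (n < k)%N -> fps_coef (p ^+ k) n = 0.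
Proof.
move=> p0; elim: k n => // k IHk n lt_nk.
rewrite exprS coef_fpsM big1 // => -[[|j] lt_jn] _ /=.
  by rewrite p0 mul0r.
by rewrite IHk ?mulr0 //; lia.
Qed.

Lemma coef_fps_comp_wide f p N n : fps_coef p 0 = 0 -> (n <= N)%N ->
  fps_coef (fps_comp f p) n
    = \sum_(k < N.+1) fps_coef f k * fps_coef (p ^+ k) n.
Proof.
move=> p0 le_nN.
rewrite /= (big_ord_widen N.+1
  (fun k => fps_coef f k * fps_coef (p ^+ k) n)) //.
rewrite [LHS]big_mkcond; apply: eq_bigr => k _ /=; case: ifPn => //.
by rewrite -leqNgt => lt_nk; rewrite coef_fps_exp_lt ?mulr0.
Qed.

Lemma coef_map_in_algM (Q : {poly K}) k a :
  (map_poly (in_alg (fps K)) Q)`_k * a = Q`_k *: a.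
Proof. by rewrite coef_map; exact: mulr_algl. Qed.

(** Turns composition into polynomial evaluation, so that the multiplicativity in [fps_compM] comes
    from [hornerM]. *)
Lemma coef_fps_comp_horner f p N n : fps_coef p 0 = 0 -> (n <= N)%N ->
  fps_coef (fps_comp f p) n
    = fps_coef (map_poly (in_alg (fps K)) (fps_trunc N.+1 f)).[p] n.
Proof.
move=> p0 le_nN; rewrite (coef_fps_comp_wide _ p0 le_nN).
rewrite (@horner_coef_wide _ N.+1); last first.
  by rewrite (leq_trans (size_poly _ _)) ?size_poly.
rewrite coef_fps_sum; apply: eq_bigr => k _.
by rewrite coef_map_in_algM coef_fpsZ coef_fps_trunc.
Qed.

Lemma fps_compM f g p : fps_coef p 0 = 0 ->
  fps_comp (f * g) p = fps_comp f p * fps_comp g p.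
Proof.
move=> p0; apply/fpsP => n; rewrite coef_fpsM.
set Q := fps_trunc n.+1 f * fps_trunc n.+1 g.
transitivity (fps_coef (map_poly (in_alg (fps K)) Q).[p] n).
  rewrite (@horner_coef_wide _ (size Q + n).+1); last first.
    by rewrite (leq_trans (size_poly _ _)) //; lia.
  rewrite (coef_fps_comp_wide _ p0 (leq_addl (size Q) n)) coef_fps_sum.
  apply: eq_bigr => k _; rewrite coef_map_in_algM coef_fpsZ.
  (* [Q] is only known to agree with [f * g] up to degree [n]; beyond it, [p ^+ k] has no term of
     index [n]. *)
  have [le_kn|lt_nk] := leqP k n; last by rewrite coef_fps_exp_lt ?mulr0.
  by rewrite -fps_mul_trunc.
rewrite rmorphM hornerM coef_fpsM; apply: eq_bigr => j _.
by rewrite -!coef_fps_comp_horner ?leq_subr // -ltnS.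
Qed.

Lemma fps_comp1 p : fps_comp 1 p = 1.
Proof.
apply/fpsP => n; rewrite /= big_ord_recl mul1r big1 ?addr0 // => i _.
by rewrite mul0r.
Qed.

Lemma fps_compXn f p k : fps_coef p 0 = 0 ->
  fps_comp (f ^+ k) p = fps_comp f p ^+ k.
Proof.
move=> p0; elim: k => [|k IHk]; first exact: fps_comp1.
by rewrite !exprS fps_compM ?IHk.
Qed.

Lemma fps_compX p : fps_coef p 0 = 0 -> fps_comp fpsX p = p.
Proof.
move=> p0; apply/fpsP => n; rewrite (coef_fps_comp_wide _ p0 (leqnSn n)).
rewrite !big_ord_recl /= mul0r mul1r add0r.
by rewrite big1 ?addr0 // => i _; rewrite mul0r.
Qed.

Lemma fps_compB f g p : fps_comp (f - g) p = fps_comp f p - fps_comp g p.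
Proof.
by apply/fpsP => n /=; rewrite -sumrB; apply: eq_bigr => i _; rewrite mulrBl.
Qed.

Definition fps_deriv a : fps K := FPS (fun n => fps_coef a n.+1 *+ n.+1).

Lemma coef_fps_deriv a n : fps_coef (fps_deriv a) n = fps_coef a n.+1 *+ n.+1.
Proof. by []. Qed.

Lemma fps_derivM a b :
  fps_deriv (a * b) = fps_deriv a * b + a * fps_deriv b.
Proof.
apply/fpsP => n; rewrite coef_fps_deriv (@fps_mul_trunc _ n.+2) //.
rewrite -coef_deriv derivM coefD coef_fpsD !coefM !coef_fpsM.
congr (_ + _); apply: eq_bigr => j _; have := ltn_ord j => lt_j.
  by rewrite coef_deriv !coef_fps_trunc //; lia.
by rewrite coef_deriv !coef_fps_trunc //; lia.
Qed.

Lemma fps_deriv1 : fps_deriv 1 = 0.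
Proof. by apply/fpsP => n /=; rewrite mul0rn. Qed.

Lemma fps_derivX : fps_deriv fpsX = 1.
Proof. by apply/fpsP => -[|n] //=; rewrite mul0rn. Qed.

Lemma fps_derivXn a k : fps_deriv (a ^+ k.+1) = a ^+ k * fps_deriv a *+ k.+1.
Proof.
elim: k => [|k IHk]; first by rewrite mul1r.
rewrite exprS fps_derivM IHk [in RHS]mulrS exprS.
by rewrite [fps_deriv a * _]mulrC mulrnAr !mulrA.
Qed.

(** Row [i] lists the coefficients of an [i]-th power, and powers commute with substitution.
    Truncation is exact because [a ^+ k] starts at index [k]. *)
Lemma fps_exp_matrix_mul a b n : fps_coef a 0 = 0 ->
  (\matrix_(i < n.+1, j < n.+1) fps_coef (b ^+ i) j)
    *m (\matrix_(i < n.+1, j < n.+1) fps_coef (a ^+ i) j)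
  = \matrix_(i, j) fps_coef (fps_comp b a ^+ i) j.
Proof.
move=> a0; apply/matrixP => i j; rewrite !mxE -fps_compXn //.
rewrite (@coef_fps_comp_wide _ _ n) -1?ltnS //.
by apply: eq_bigr => k _; rewrite !mxE.
Qed.

(* The truncated matrix of the powers of [b] is a left, hence a right, inverse
   of that of the powers of [a]. *)
Lemma fps_comp_inverseC a b : fps_coef a 0 = 0 -> fps_coef b 0 = 0 ->
  fps_comp b a = fpsX -> fps_comp a b = fpsX.
Proof.
move=> a0 b0 ba; apply/fpsP => n.
have idX : \matrix_(i < n.+2, j < n.+2) fps_coef (fpsX ^+ i : fps K) j = 1%:M.
  by apply/matrixP => i j; rewrite !mxE coef_fpsXn eq_sym.
have := fps_exp_matrix_mul b n.+1 a0; rewrite ba idX => /mulmx1C.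
(* Row 1 is the composite itself; size [n.+2] leaves room for both row 1 and column [n]. *)
rewrite fps_exp_matrix_mul // => /matrixP/(_ (Ordinal (erefl : 1 < n.+2)%N)).
move=> /(_ (Ordinal (leqnSn n.+1))); rewrite !mxE /= => ->.
by rewrite -val_eqE /= eq_sym.
Qed.

End FpsTheory.

Lemma mulrnS_inj (K : numFieldType) n : injective (fun x : K => x *+ n.+1).
Proof. by move=> x y /eqP; rewrite Num.Theory.eqr_pMn2r // => /eqP. Qed.

(** * Lagrange inversion through residues *)

Section Lagrange.
Variable K : numFieldType.
Implicit Types (f b : fps K) (n k r : nat).

Variables q phi : fps K.
Hypotheses (q0 : fps_coef q 0 = 1) (q_phi : q * phi = 1).

Let a : fps K := fpsX * q.

Let a0 : fps_coef a 0 = 0.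
Proof. exact: coef_fpsXM0. Qed.

(* This is the residue of [a^(-r-1) a'], which for [r > 0] vanishes because
   [a^(-r-1) a'] is the derivative of [- a^(-r) / r]. *)
Lemma lagrange_residue r :
  fps_coef (fps_deriv a * phi ^+ r.+1) r = (r == 0%N)%:R.
Proof.
have phi0 : fps_coef phi 0 = 1.
  by have /fpsP/(_ 0%N) := q_phi; rewrite coef_fpsM0 q0 mul1r.
have Da : fps_deriv a = q + fpsX * fps_deriv q.
  by rewrite fps_derivM fps_derivX mul1r.
have Dphi : fps_deriv q * phi + q * fps_deriv phi = 0.
  by rewrite -fps_derivM q_phi fps_deriv1.
case: r => [|r].
  rewrite Da expr1 mulrDl q_phi -mulrA coef_fpsD coef_fpsXM0 addr0.
  by rewrite coef_fps1.
have -> : fps_deriv a * phi ^+ r.+2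
            = phi ^+ r.+1 - fpsX * (phi ^+ r * fps_deriv phi).
  rewrite Da.
  (* Adding a multiple of (q phi)' = 0 trades the derivative of [q] for that of [phi]. *)
  have -> : (q + fpsX * fps_deriv q) * phi ^+ r.+2
    = q * phi * phi ^+ r.+1
      + fpsX * phi ^+ r.+1 * (fps_deriv q * phi + q * fps_deriv phi)
      - q * phi * fpsX * (phi ^+ r * fps_deriv phi).
    by rewrite !exprS; ring.
  by rewrite Dphi q_phi; ring.
(* Multiplied by [r.+1], the second term is the coefficient of index [r] of the derivative of
   [phi ^+ r.+1], which cancels the first. *)
apply: (@mulrnS_inj _ r); rewrite coef_fpsB coef_fpsXMS mulrnBl.
rewrite -[X in _ - X]coef_fpsMn -fps_derivXn coef_fps_deriv subrr.
by rewrite mul0rn.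
Qed.

Lemma lagrange_inversion f n :
  fps_coef (fps_deriv (fps_comp f a) * phi ^+ n.+1) n
    = fps_coef f n.+1 *+ n.+1.
Proof.
(* Coefficients up to [n] of a derivative involve indices up to [n.+1], so one bound on [k] serves
   every [j] and the sums can be exchanged. *)
transitivity (\sum_(k < n.+2)
    fps_coef f k * fps_coef (fps_deriv (a ^+ k) * phi ^+ n.+1) n).
  rewrite coef_fpsM; under [RHS]eq_bigr do rewrite coef_fpsM mulr_sumr.
  rewrite exchange_big; apply: eq_bigr => j _.
  rewrite coef_fps_deriv (@coef_fps_comp_wide _ _ _ n.+1) ?ltnS ?leq_ord //.
  rewrite -sumrMnl mulr_suml; apply: eq_bigr => k _.
  by rewrite coef_fps_deriv !mulrnAl mulrnAr mulrA.
(* The term [k = n.+1] has residue index 0 and gives the right-hand side; all others vanish. *)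
rewrite big_ord_recr [nat_of_ord ord_max]/= big1 => [|k _].
  rewrite fps_derivXn exprMn mulrnAl coef_fpsMn.
  have -> : fpsX ^+ n * q ^+ n * fps_deriv a * phi ^+ n.+1
    = fpsX ^+ n * ((q * phi) ^+ n * (fps_deriv a * phi ^+ 1)).
    by rewrite exprSr exprMn; ring.
  rewrite q_phi expr1n mul1r coef_fpsXnM ltnn subnn lagrange_residue.
  by rewrite eqxx mulrnAr mulr1; exact: add0r.
case: k => -[|k] lt_kn; rewrite [nat_of_ord _]/=.
  by rewrite fps_deriv1 mul0r mulr0.
rewrite fps_derivXn exprMn mulrnAl coef_fpsMn.
(* The power of [a] is now [k.+1], so the residue index is [n - k], which is positive. *)
have le_kn : (k < n)%N by [].
have -> : phi ^+ n.+1 = phi ^+ k * phi ^+ (n - k).+1.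
  by rewrite -exprD; congr (_ ^+ _); lia.
have -> : fpsX ^+ k * q ^+ k * fps_deriv a * (phi ^+ k * phi ^+ (n - k).+1)
    = fpsX ^+ k * ((q * phi) ^+ k * (fps_deriv a * phi ^+ (n - k).+1)).
  by rewrite exprMn; ring.
rewrite q_phi expr1n mul1r coef_fpsXnM ltnNge (ltnW le_kn) lagrange_residue.
by rewrite subn_eq0 leqNgt le_kn mul0rn mulr0.
Qed.

Lemma formal_inverse_lagrange b : formal_inverse a b <->
  fps_coef b 0 = 0 /\
  forall n, fps_coef b n.+1 *+ n.+1 = fps_coef (phi ^+ n.+1) n.
Proof.
have phi0 k : fps_coef (phi ^+ k) 0 = 1.
  have /fpsP/(_ 0%N) := q_phi; rewrite coef_fpsM0 coef_fpsX0 q0 mul1r => ->.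
  by rewrite expr1n.
split=> [[b0 _ ba]|[b0 bE]].
  by split=> // n; rewrite -lagrange_inversion ba fps_derivX mul1r.
suff ba : fps_comp b a = fpsX by split=> //; exact: fps_comp_inverseC ba.
(* The terms [j < n] agree by induction, and the diagonal entry of the system, the constant term of
   [phi ^+ n.+1], is 1. *)
have Dba n : fps_coef (fps_deriv (fps_comp b a)) n = fps_coef (1 : fps K) n.
  elim/ltn_ind: n => n IHn.
  have := lagrange_inversion b n; rewrite bE -[X in _ = fps_coef X n -> _]mul1r.
  rewrite !coef_fpsM !big_ord_recr /= subnn !phi0 !mulr1.
  rewrite (eq_bigr (fun j : 'I_n => fps_coef (1 : fps K) j
    * fps_coef (phi ^+ n.+1) (n - j))) => [/addrI //|j _].
  by rewrite -IHn ?ltn_ord.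
apply/fpsP => -[|n]; first by rewrite /= big_ord1 b0 mul0r.
apply: (@mulrnS_inj _ n); rewrite -!coef_fps_deriv Dba.
by rewrite fps_derivX.
Qed.

End Lagrange.

HB.instance Definition _ (K : comNzRingType) :=
  GRing.Lalgebra_isComAlgebra.Build K (fps K).

(** * Negative powers of 1 - X *)

Section NegativeBinomial.
Variable K : comNzRingType.
Implicit Types (p : fps K) (r : nat).

(** The expansion of (1 - X)^-(r+1). *)
Definition fps_negbin r : fps K := FPS (fun s => 'C(r + s, s)%:R).

Lemma mul_1BX_negbin0 : (1 - fpsX) * fps_negbin 0 = 1.
Proof.
apply/fpsP => -[|n]; rewrite mulrBl mul1r coef_fpsB.
  by rewrite coef_fpsXM0 subr0.
by rewrite coef_fpsXMS /= !binn subrr.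
Qed.

(** This is Pascal's rule. *)
Lemma mul_1BX_negbinS r : (1 - fpsX) * fps_negbin r.+1 = fps_negbin r.
Proof.
apply/fpsP => -[|n]; rewrite mulrBl mul1r coef_fpsB.
  by rewrite coef_fpsXM0 subr0 /= !bin0.
rewrite coef_fpsXMS /= [in X in _ - X]addSnnS addSn binS natrD.
by rewrite -addrA subrr addr0.
Qed.

Lemma fps_negbinE r : fps_negbin r = fps_negbin 0 ^+ r.+1.
Proof.
elim: r => // r IHr; rewrite exprS -IHr -(mul_1BX_negbinS r) mulrA.
by rewrite [fps_negbin 0 * _]mulrC mul_1BX_negbin0 mul1r.
Qed.

(** Provides the inverse [phi] of [q = 1 - p] required by Lagrange inversion. *)
Lemma mul_1B_comp_negbin0 p : fps_coef p 0 = 0 ->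
  (1 - p) * fps_comp (fps_negbin 0) p = 1.
Proof.
move=> p0; rewrite -{1}(fps_compX p0) -(fps_comp1 p) -fps_compB.
by rewrite -fps_compM // mul_1BX_negbin0.
Qed.

End NegativeBinomial.

(** * The multinomial theorem in a commutative algebra *)

Section Multinomial.
Variables (K : numFieldType) (A : comAlgType K).

Let trunc_exp N (x : A) : {poly A} := \poly_(k < N.+1) ((k`!)%:R^-1 *: x ^+ k).

Let natf_fact_neq0 k : (k`!)%:R != 0 :> K.
Proof. by rewrite Num.Theory.pnatr_eq0 -lt0n fact_gt0. Qed.

(** The induction step is exp(x + y) = exp(x) exp(y) in degree [s], that is, the binomial theorem
    divided by s!. *)
Let coef_prod_trunc_exp N s (I : Type) (r : seq I) (x : I -> A) : (s <= N)%N ->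
  (\prod_(i <- r) trunc_exp N (x i))`_s
    = (s`!)%:R^-1 *: (\sum_(i <- r) x i) ^+ s.
Proof.
elim: r s => [|i r IHr] s le_sN.
  rewrite !big_nil coef1 expr0n; case: s le_sN => [|s] _.
    by rewrite invr1 scale1r.
  by rewrite scaler0.
rewrite !big_cons coefM addrC exprDn scaler_sumr; apply: eq_bigr => j _.
have le_js : (j <= s)%N by rewrite -ltnS.
rewrite IHr ?(leq_trans (leq_subr _ _)) // coef_poly ltnS (leq_trans le_js) //.
rewrite -scalerAl -scalerAr scalerA mulrC -scaler_nat scalerA.
congr (_ *: _); last exact: mulrC.
rewrite -(bin_fact le_js) !natrM; apply/(mulfI (natf_fact_neq0 j)).
have : 'C(s, j)%:R != 0 :> K by rewrite Num.Theory.pnatr_eq0 -lt0n bin_gt0.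
move: (natf_fact_neq0 j) (natf_fact_neq0 (s - j)) => ? ? ?.
by field; apply/and3P.
Qed.

(* The formula is the coefficient of index [s] of the product of the truncated
   exponentials [\sum_(k <= N) x_i^k T^k / k!] in an auxiliary variable [T]. *)
Lemma exprn_sum_multinomial N s (I : finType) (x : I -> A) : (s <= N)%N ->
  (\sum_i x i) ^+ s
    = \sum_(j : {ffun I -> 'I_N.+1} | (\sum_i j i == s)%N)
        ((s`!)%:R / (\prod_i (j i)`!)%:R) *: \prod_i x i ^+ j i.
Proof.
move=> le_sN; have := coef_prod_trunc_exp (index_enum I) x le_sN.
move/(congr1 ( *:%R (s`!)%:R)); rewrite scalerA divff // scale1r => <-.
under eq_bigr do rewrite /trunc_exp poly_def.
rewrite bigA_distr_bigA coef_sum scaler_sumr [RHS]big_mkcond.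
apply: eq_bigr => j _; rewrite scaler_prod prodrXr coefZ coefXn eq_sym.
case: eqP => _; last by rewrite mulr0 scaler0.
by rewrite mulr1 scaler_prod scalerA natr_prod prodfV.
Qed.

End Multinomial.

(** * The numbers u_n as coefficients of powers of 1/(1 - p) *)

Section InverseCoefficients.
Variables (K : numFieldType) (m : nat) (alpha : nat -> K).

Let p : fps K := \sum_(1 <= k < m.+1) alpha k *: fpsX ^+ k.

Lemma coef_fps_linear_comb0 : fps_coef p 0 = 0.
Proof.
rewrite /p big_add1 big_mkord coef_fps_sum big1 // => i _.
by rewrite coef_fpsZ coef_fpsXn mulr0.
Qed.

(** The multinomial theorem fixes the sum of the exponents, and the power of X fixes their weight.
    Bounding exponents by [n] instead of [s] gives the index type of [inv_coef]. *)
Lemma coef_exp_fps_sum s n : (s <= n)%N ->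
  fps_coef (p ^+ s) n
    = \sum_(j : {ffun 'I_m -> 'I_n.+1}
            | (\sum_(i < m) j i == s)%N && (\sum_(i < m) i.+1 * j i == n)%N)
        (s`!)%:R / (\prod_i (j i)`!)%:R * \prod_(i < m) alpha i.+1 ^+ j i.
Proof.
move=> le_sn; rewrite /p big_add1 big_mkord (exprn_sum_multinomial _ le_sn).
rewrite coef_fps_sum big_mkcondr; apply: eq_bigr => j _; rewrite coef_fpsZ.
rewrite (eq_bigr (fun i : 'I_m => alpha i.+1 ^+ j i *: fpsX ^+ (i.+1 * j i)));
  last by move=> i _; rewrite exprZn -exprM.
rewrite scaler_prod prodrXr coef_fpsZ coef_fpsXn eq_sym.
by case: eqP => _; rewrite ?mulr1 ?mulr0.
Qed.

Lemma inv_coefE n :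
  inv_coef m alpha n = fps_coef (fps_comp (fps_negbin K 0) p ^+ n.+1) n.
Proof.
have le_deg (j : {ffun 'I_m -> 'I_n.+1}) :
    (\sum_(i < m) i.+1 * j i)%N = n -> (\sum_(i < m) j i < n.+1)%N.
  move=> wt_j; rewrite ltnS -[leqRHS]wt_j leq_sum // => i _.
  by rewrite leq_pmull.
rewrite -fps_compXn ?coef_fps_linear_comb0 // -fps_negbinE /inv_coef.
(* Terms are grouped by the sum of their exponents; [inord] is exact here, since that sum is at most
   the weight [n]. *)
rewrite (partition_big (fun j : {ffun 'I_m -> 'I_n.+1} =>
           inord (\sum_(i < m) j i) : 'I_n.+1) xpredT) //= mulr_sumr.
apply: eq_bigr => s _; have le_sn : (s <= n)%N by rewrite -ltnS.
rewrite coef_exp_fps_sum // !mulr_sumr; apply: eq_big => j.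
  rewrite andbC; apply: andb_id2r => /eqP/le_deg lt_j.
  by rewrite -val_eqE /= inordK.
case/andP => /eqP/le_deg lt_j; rewrite -val_eqE /= inordK // => /eqP ->.
(* Writing (n+s)! as 'C(n+s, s) s! n! separates the negative binomial coefficient from the
   multinomial one. *)
have le_s : (s <= n + s)%N by rewrite leq_addl.
rewrite -(bin_fact le_s) addnK !natrM !mulrA; congr (_ / _ * _).
by rewrite mulrC !mulrA mulfV ?mul1r // Num.Theory.pnatr_eq0 -lt0n fact_gt0.
Qed.

End InverseCoefficients.

(** * Solving the weight constraint for the first index *)

Section EliminateFirstIndex.
Variables (K : fieldType) (alpha : nat -> K).
Hypothesis alpha1_neq0 : alpha 1%N != 0.

Let x k := alpha k / alpha 1%N ^+ k.

Lemma inv_coef_normalized m n :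
  inv_coef m.+1 alpha n = alpha 1%N ^+ n / (n`!)%:R *
    \sum_(j : {ffun 'I_m -> 'I_n.+1} | (\sum_(i < m) i.+2 * j i <= n)%N)
      ((2 * n - \sum_(i < m) i.+1 * j i)`!)%:R
      / ((n - \sum_(i < m) i.+2 * j i)`! * \prod_(i < m) (j i)`!)%:R
      * \prod_(i < m) x i.+2 ^+ j i.
Proof.
(* [w] is the weight of the indices from the second on; [extend] restores j_1 as [n - w j], and
   [tail] forgets it. *)
pose w (j : {ffun 'I_m -> 'I_n.+1}) := (\sum_(i < m) i.+2 * j i)%N.
pose extend (j : {ffun 'I_m -> 'I_n.+1}) : {ffun 'I_m.+1 -> 'I_n.+1} :=
  [ffun i => oapp j (inord (n - w j)) (unlift ord0 i)].
pose tail (j : {ffun 'I_m.+1 -> 'I_n.+1}) : {ffun 'I_m -> 'I_n.+1} :=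
  [ffun i => j (lift ord0 i)].
have extend0 j : extend j ord0 = (n - w j)%N :> nat.
  by rewrite ffunE unlift_none /= inordK // ltnS leq_subr.
have extendS j i : extend j (lift ord0 i) = j i by rewrite ffunE liftK.
have extendK : cancel extend tail.
  by move=> j; apply/ffunP => i; rewrite ffunE extendS.
have wt_extend j : (\sum_(i < m.+1) i.+1 * extend j i = n - w j + w j)%N.
  rewrite big_ord_recl extend0 mul1n; congr (_ + _)%N.
  by apply: eq_bigr => i _; rewrite extendS.
rewrite /inv_coef (reindex_onto extend tail) /=; last first.
  move=> j; rewrite big_ord_recl mul1n => /eqP wt_j.
  apply/ffunP => i; apply: val_inj; case: (unliftP ord0 i) => [k|] ->.
    by rewrite extendS ffunE.
  rewrite [LHS]extend0 -[X in (X - _)%N]wt_j /w.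
  rewrite [X in (_ - X)%N](eq_bigr (fun i : 'I_m => i.+2 * j (lift ord0 i)))%N.
    by rewrite addnK.
  by move=> k _; rewrite ffunE.
rewrite [alpha 1%N ^+ n / _]mulrC -mulrA; congr (_ * _); rewrite mulr_sumr.
apply: eq_big => [j|j /andP[]]; rewrite wt_extend ?extendK ?eqxx ?andbT.
  (* With truncated subtraction, [n - w j + w j = n] says exactly that [w j <= n]. *)
  by rewrite -/(w j); apply/eqP/idP; lia.
move=> /eqP wt_j _; have le_wn : (w j <= n)%N by rewrite -wt_j leq_addl.
have wE : (w j = \sum_(i < m) j i + \sum_(i < m) i.+1 * j i)%N.
  by rewrite -big_split; apply: eq_bigr => i _; rewrite mulSn.
have -> : (\sum_(i < m.+1) extend j i = n - w j + \sum_(i < m) j i)%N.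
  by rewrite big_ord_recl extend0; under eq_bigr do rewrite extendS.
have -> : (\prod_(i < m.+1) (extend j i)`!
           = (n - w j)`! * \prod_(i < m) (j i)`!)%N.
  by rewrite big_ord_recl extend0; under eq_bigr do rewrite extendS.
have -> : (n + (n - w j + \sum_(i < m) j i)
           = 2 * n - \sum_(i < m) i.+1 * j i)%N by lia.
rewrite big_ord_recl extend0.
rewrite [RHS]mulrCA; congr (_ * _).
(* The first factor is the power with exponent j_1; the second is absorbed by the denominators of
   the [x k]. *)
have -> : alpha 1%N ^+ n = alpha 1%N ^+ (n - w j) * alpha 1%N ^+ w j.
  by rewrite -exprD wt_j.
rewrite -mulrA; congr (_ * _).
rewrite /w -prodrXr -big_split; apply: eq_bigr => i _ /=.
by rewrite extendS expr_div_n -exprM mulrCA mulfV ?mulr1 // expf_neq0.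
Qed.

Lemma inv_coef2 n :
  inv_coef 2 alpha n = alpha 1%N ^+ n / (n`!)%:R *
    \sum_(0 <= k < (n./2).+1)
      ((2 * n - k)`!)%:R / ((n - 2 * k)`! * k`!)%:R * x 2 ^+ k.
Proof.
rewrite inv_coef_normalized; congr (_ * _).
(* Only j_2 remains, and families over ['I_1] are constants. *)
rewrite (reindex (fun k : 'I_n.+1 => [ffun=> k] : {ffun 'I_1 -> 'I_n.+1})) /=.
  rewrite (big_nat_widen _ _ n.+1); last by lia.
  rewrite big_mkord; apply: eq_big => k; rewrite !big_ord1 ffunE.
    by rewrite /=; lia.
  by rewrite mul1n.
exists (fun j => j ord0) => [k _|j _]; first by rewrite ffunE.
by apply/ffunP => i; rewrite ffunE (ord1 i).
Qed.

End EliminateFirstIndex.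

(* Only alpha 1, ..., alpha m are used.  In the second formula the ordinal
   i < m.-1 stands for the index i + 2; the subtractions on nat are exact under
   the summation constraints. *)
Theorem lemma2p20 (R : realType) (m : nat) (alpha : nat -> R[i])
    (hm : (0 < m)%N) :
  let u := inv_coef m alpha in
  [/\ (forall b : fps R[i],
         formal_inverse
           (fpsX * (1 - \sum_(1 <= k < m.+1) alpha k *: fpsX ^+ k)) b
         <->
         b = fpsX * (1 + FPS (fun n => if n is 0 then 0
                                       else (n.+1)%:R^-1 * u n))),
      ((2 <= m)%N -> alpha 1%N != 0 ->
       let x k := alpha k / alpha 1%N ^+ k in
       forall n : nat, (1 <= n)%N ->
         u n = alpha 1%N ^+ n / (n`!)%:R *
           \sum_(j : {ffun 'I_m.-1 -> 'I_n.+1}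
                 | (\sum_(i < m.-1) i.+2 * j i <= n)%N)
             ((2 * n - \sum_(i < m.-1) i.+1 * j i)`!)%:R
             / ((n - \sum_(i < m.-1) i.+2 * j i)`!
                * \prod_(i < m.-1) (j i)`!)%:R
             * \prod_(i < m.-1) x i.+2 ^+ j i)
    & (m = 2%N -> alpha 1%N != 0 ->
       let x := alpha 2%N / alpha 1%N ^+ 2 in
       forall n : nat, (1 <= n)%N ->
         u n = alpha 1%N ^+ n / (n`!)%:R *
           \sum_(0 <= k < (n./2).+1)
             ((2 * n - k)`!)%:R / ((n - 2 * k)`! * k`!)%:R * x ^+ k)].
Proof.
move=> u; split=> [b|le2m alpha1_neq0 x n _|m2 alpha1_neq0 x n _]; last 2 first.
- by rewrite /u -{1}(prednK hm); exact: inv_coef_normalized.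
- by rewrite /u m2; exact: inv_coef2.
set p := \sum_(1 <= k < m.+1) alpha k *: fpsX ^+ k.
have p0 : fps_coef p 0 = 0 by exact: coef_fps_linear_comb0.
have q0 : fps_coef (1 - p) 0 = 1 by rewrite coef_fpsB p0 subr0.
set B := (X in _ <-> b = X).
have BE n : fps_coef B n.+1 *+ n.+1 = u n.
  (* At index 0 the summand 1 of [B] supplies u_0 = 1, as the other series is 0 there. *)
  rewrite coef_fpsXMS coef_fpsD; case: n => [|n].
    by rewrite /u inv_coefE coef_fpsX0 /= big_ord1 addr0 expr1 bin0 mulr1.
  rewrite coef_fps1 add0r -[LHS]mulr_natl mulrA mulfV ?mul1r //.
  by rewrite Num.Theory.pnatr_eq0.
rewrite (formal_inverse_lagrange q0 (mul_1B_comp_negbin0 p0)).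
split=> [[b0 bE]|->].
  apply/fpsP => -[|n]; first by rewrite b0 coef_fpsXM0.
  by apply: (@mulrnS_inj _ n); rewrite bE BE /u inv_coefE.
by split=> [|n]; rewrite ?coef_fpsXM0 // BE /u inv_coefE.
Qed.
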